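(* Let $\mathcal{K}\hookrightarrow\mathcal{L}$ be an inclusion of simplicial complexes, where $\mathcal{L}$ is a $(q+1)$-dimensional orientable pseudomanifold without boundary. Let $G$ be the dual graph, i.e. the graph with incidence matrix given by the transpose of $B_{q+1}^{\mathcal{L},\mathcal{K}}$. Then $$\varphi_q^{\mathcal{K},\mathcal{L}}=\frac{2}{\operatorname{diam}(G)}.$$
   Context: **Chains.** Simplicial complexes are finite. $S_q^{\mathcal{X}}$ is the set of $q$-simplices of $\mathcal{X}$ and $C_q^{\mathcal{X}}$ the real $q$-chains with the inner product making oriented $q$-simplices orthonormal; $B_{q+1}^{\mathcal{L}}$ is the matrix of the boundary operator $\partial_{q+1}^{\mathcal{L}}:C_{q+1}^{\mathcal{L}}\to C_q^{\mathcal{L}}$ in the bases of oriented simplices. $C_{q+1}^{\mathcal{L},\mathcal{K}}=\{c\in C_{q+1}^{\mathcal{L}}:\partial_{q+1}^{\mathcal{L}}c\in C_q^{\mathcal{K}}\}$. **Pseudomanifolds.** $\mathcal{L}$ of dimension $q+1$ is an orientable pseudomanifold if every $q$-simplex is a face of at most two $(q+1)$-simplices and the $(q+1)$-simplices can be oriented so as to induce opposite orientations on shared $q$-faces; such orientations are fixed. Without boundary: every $q$-simplex is a face of either no or two $(q+1)$-simplices. **Dual graph $G$.** $C_{q+1}^{\mathcal{L},\mathcal{K}}$ has a basis $c_1,\dots,c_m$ of $0/1$ indicator chains of $(q+1)$-simplices with pairwise disjoint supports. $B_{q+1}^{\mathcal{L},\mathcal{K}}$ is the matrix, with rows indexed by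 $S_q^{\mathcal{K}}$ and columns by $c_1,\dots,c_m$, of $\partial_{q+1}^{\mathcal{L}}$ restricted to $C_{q+1}^{\mathcal{L},\mathcal{K}}$. Each row is zero or has exactly two nonzero entries, $+1$ and $-1$; thus the transpose is the incidence matrix (rows indexed by vertices, columns by edges) of the (multi)graph $G$ with vertices $\{1,\dots,m\}$ and one edge for each nonzero row, joining the two indices where that row is nonzero. $G$ is taken to be connected. $\operatorname{diam}(G)$ is the maximum, over all pairs of vertices, of the length of a shortest path joining them. **Cheeger constant.** Let $B$ be the submatrix of $B_{q+1}^{\mathcal{L}}$ consisting of the rows indexed by $S_q^{\mathcal{K}}$, and $P$ the orthogonal projection of $C_{q+1}^{\mathcal{L}}$ onto $C_{q+1}^{\mathcal{L},\mathcal{K}}$. Then $$\varphi_q^{\mathcal{K},\mathcal{L}}=\min_{\substack{0\ne x\in C_q^{\mathcal{K}}\\ x\perp^1\ker(PB^T)}}\frac{\|PB^Tx\|_1}{\|x\|_1},$$ where $x\perp^1Y$ means $\|x+y\|_1\ge\|x\|_1$ for all $y\in Y$. *)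

(* Defs.v *)
From HB Require Import structures.
From mathcomp Require Import all_boot all_order all_algebra.
From mathcomp Require Import all_classical all_reals ereal.

Set Implicit Arguments.
Unset Strict Implicit.
Unset Printing Implicit Defensive.

Import Order.TTheory GRing.Theory Num.Theory.
Local Open Scope ring_scope.

Section Complexes.
Variable V : finType.
Implicit Types (K L : {set {set V}}) (q : nat) (s t : {set V}).

Definition simplicial_complex L : Prop :=
  finset.set0 \notin L /\
  forall s t, s \in L -> t \subset s -> t != finset.set0 -> t \in L.

Definition simplices L q : {set {set V}} := [set s in L | #|s| == q.+1].

Definition cofaces L q t : {set {set V}} :=
  [set s in simplices L q.+1 | t \subset s].

Definition has_dimension L q : Prop := (\max_(s in L) #|s|)%N = q.+1.

End Complexes.

Section Chains.
Variables (R : realType) (V : finType).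
Implicit Types (K L : {set {set V}}) (q : nat) (s t : {set V}).
(* A choice of orientation of every simplex: [o s] is false when [s] carries the
   orientation [v_0, ..., v_k] in which its vertices are listed by [enum s],
   and true when it carries the opposite one. *)
Implicit Type o : {set V} -> bool.

(* Real-valued functions on vertex sets; [c s] is the coefficient of [c] on the
   oriented simplex [s].  [R^o] is [R] seen as a vector space over itself. *)
Definition chain := {ffun {set V} -> R^o}.

Definition simplex_chain s : chain := [ffun t => (t == s)%:R].

Definition chains L q : {vspace chain} :=
  <<[seq simplex_chain s | s <- enum (simplices L q)]>>%VS.

Definition inner (x y : chain) : R := \sum_s x s * y s.

Definition norm1 (x : chain) : R := \sum_s `|(x s : R)|.

(* The coefficient of the oriented simplex [t] in the boundary of the oriented
   simplex [s], from
     d [v_0, ..., v_k] = \sum_i (-1)^i [v_0, ..., v_{i-1}, v_{i+1}, ..., v_k];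
   it is 0 unless [t] is a facet of [s]. *)
Definition incidence o t s : R :=
  (-1) ^+ o t * (-1) ^+ o s *
  \sum_(v in s | s :\ v == t) (-1) ^+ index v (enum s).

Definition boundary L q o (c : chain) : chain :=
  [ffun t => if t \in simplices L q
             then \sum_(s in simplices L q.+1) incidence o t s * (c s : R)
             else 0].

Fact boundary_is_linear L q o : linear (boundary L q o).
Proof.
move=> a x y; apply/ffunP => t; rewrite !ffunE; case: ifP => _; last first.
  by rewrite scaler0 addr0.
rewrite scaler_sumr -big_split /=; apply: eq_bigr => s _.
rewrite !ffunE /= mulrDr; congr (_ + _).
exact: mulrCA.
Qed.

HB.instance Definition _ L q o :=
  GRing.isLinear.Build R chain chain *:%R (boundary L q o)
    (boundary_is_linear L q o).

(* { c in C_{q+1}^L | d c in C_q^K } *)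
Definition relative_chains K L q o : {vspace chain} :=
  (chains L q.+1 :&: linfun (boundary L q o) @^-1: chains K q)%VS.

(* x |-> B^T x, where B consists of the rows of the matrix of [boundary L q o]
   indexed by the q-simplices of K. *)
Definition coboundary K L q o (x : chain) : chain :=
  [ffun s => if s \in simplices L q.+1
             then \sum_(t in simplices K q) incidence o t s * (x t : R)
             else 0].

Definition is_orthogonal_projection (W : {vspace chain}) (x y : chain) : Prop :=
  y \in W /\ forall w, w \in W -> inner (x - y) w = 0.

Definition projection (W : {vspace chain}) (x : chain) : chain :=
  xget 0 [set y | is_orthogonal_projection W x y]%classic.

(* x |-> P B^T x *)
Definition projected_coboundary K L q o (x : chain) : chain :=
  projection (relative_chains K L q o) (coboundary K L q o x).

Definition orthogonal1 (x : chain) (Y : set chain) : Prop :=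
  forall y, Y y -> norm1 x <= norm1 (x + y).

Definition projected_coboundary_ker K L q o : set chain :=
  [set y | y \in chains K q /\ projected_coboundary K L q o y = 0]%classic.

Definition cheeger_ratios K L q o : set (\bar R) :=
  [set r | exists x, [/\ x \in chains K q, x != 0,
     orthogonal1 x (projected_coboundary_ker K L q o)
   & r = (norm1 (projected_coboundary K L q o x) / norm1 x)%:E]]%classic.

(* +oo when there is no admissible chain *)
Definition cheeger K L q o : \bar R := ereal_inf (cheeger_ratios K L q o).

(* Orientable pseudomanifold of dimension q.+1, together with a choice of
   orientations inducing opposite orientations on shared q-simplices. *)
Definition oriented_pseudomanifold L q o : Prop :=
  [/\ simplicial_complex L,
      has_dimension L q.+1,
      forall t, t \in simplices L q -> (#|cofaces L q t| <= 2)%N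
    & forall t s s', t \in simplices L q -> s \in cofaces L q t ->
        s' \in cofaces L q t -> s != s' -> incidence o t s = - incidence o t s'].

Definition without_boundary L q : Prop :=
  forall t, t \in simplices L q ->
    #|cofaces L q t| = 0%N \/ #|cofaces L q t| = 2%N.

Definition disjoint_indicator_basis K L q o m (c : m.-tuple chain) : Prop :=
  [/\ basis_of (relative_chains K L q o) c,
      forall (i : 'I_m) s, tnth c i s = 0 \/ tnth c i s = 1
    & forall (i j : 'I_m) s, i != j -> tnth c i s = 0 \/ tnth c j s = 0].

(* The entry in row [t] and column [i] of the matrix of the boundary operator
   on [relative_chains K L q o] in the basis [c]. *)
Definition relative_boundary L q o m (c : m.-tuple chain) t (i : 'I_m) : R :=
  boundary L q o (tnth c i) t.

(* The dual multigraph on 'I_m: its edges are the q-simplices of K with a nonzero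
   row, each joining the two indices at which that row is nonzero. *)
Definition dual_ends L q o m (c : m.-tuple chain) t : {set 'I_m} :=
  [set i | relative_boundary L q o c t i != 0].

Definition dual_edges K L q o m (c : m.-tuple chain) : {set {set V}} :=
  [set t in simplices K q | dual_ends L q o c t != finset.set0].

Definition dual_graph K L q o m (c : m.-tuple chain) : rel 'I_m :=
  fun i j => [exists t in dual_edges K L q o c,
    dual_ends L q o c t == [set i; j]].

End Chains.

Arguments cheeger_ratios R {V}.
Arguments cheeger R {V}.
Arguments oriented_pseudomanifold R {V}.

Section Graphs.
Variables (T : finType) (e : rel T).

Definition connected_graph : Prop := forall x y, fingraph.connect e x y.

(* The least k for which there is a walk with k edges from x to y; such a k is
   less than #|T| when x and y are connected. *)
Definition distance (x y : T) : nat :=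
  find (fun k => [exists p : k.-tuple T, path e x p && (last x p == y)])
       (iota 0 #|T|).

Definition diameter : nat := \max_x \max_y distance x y.

End Graphs.

(* Main.v *)
(* Identify a chain x on the q-simplices of K with a flow on the dual graph G.  The
   1-norm of P B^T x is the 1-norm of the divergence of x, and x is 1-orthogonal to the
   kernel iff it has minimal 1-norm among the flows with the same divergence.  Any
   divergence d can be realised by shipping its positive part to its negative part along
   geodesics, at cost at most diam(G) |d|_1 / 2, which bounds every ratio from below by
   2 / diam(G).  A geodesic between two vertices at distance diam(G) attains the bound:
   testing against the 1-Lipschitz distance function to one end shows that no flow with
   the same divergence is cheaper. *)
Require Import Defs.
From mathcomp Require Import all_boot all_order all_algebra.
From mathcomp Require Import all_classical all_reals ereal.
From mathcomp Require Import ring lra.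

Set Implicit Arguments.
Unset Strict Implicit.
Unset Printing Implicit Defensive.

Import Order.TTheory GRing.Theory Num.Theory.

(** * Walks, distances and the diameter of a finite graph *)

Section Distance.
Variables (T : finType) (e : rel T).

Lemma distance_le_size x p : path e x p -> distance e x (last x p) <= size p.
Proof.
move=> ep; rewrite /distance.
(* [find] never exceeds the length [#|T|] of the searched list, which settles the walks too long to
   be found there. *)
have [lt_p|ge_p] := ltnP (size p) #|T|; last first.
  by apply: leq_trans (find_size _ _) _; rewrite size_iota.
rewrite leqNgt; apply/negP => /(before_find 0%N); rewrite nth_iota // add0n.
move/negbT/negP; apply; apply/fintype.existsP; exists (in_tuple p); by rewrite ep eqxx.
Qed.

Lemma distance_refl x : distance e x x = 0.
Proof. by apply/eqP; rewrite -leqn0; exact: (@distance_le_size x [::]). Qed.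

Lemma distance_path x y : connect e x y ->
  exists p, [/\ path e x p, last x p = y & size p = distance e x y].
Proof.
(* A shortened walk repeats no vertex, so its length is below [#|T|], within the range searched by
   [distance]. *)
move=> /connectP[p0 ep0 ->]; case/shortenP: ep0 => p ep up _.
set a := fun k => [exists p' : k.-tuple T, path e x p' && (last x p' == last x p)].
have lt_p : size p < #|T| by rewrite -[(size p).+1]/(size (x :: p)) -(card_uniqP up) max_card.
have ha : has a (iota 0 #|T|).
  apply/hasP; exists (size p); first by rewrite mem_iota.
  by apply/fintype.existsP; exists (in_tuple p); rewrite ep eqxx.
have := nth_find 0%N ha; rewrite has_find size_iota in ha.
rewrite nth_iota // add0n => /fintype.existsP[p' /andP[ep' /eqP lp']].
by exists p'; rewrite size_tuple.
Qed.

Lemma distance_triangle_edge x y z :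
  connect e y z -> e x y -> distance e x z <= (distance e y z).+1.
Proof.
move=> /distance_path[p [ep <- <-]] exy.
by apply: (@distance_le_size x (y :: p)); rewrite /= exy.
Qed.

Lemma distance_le_diameter x y : distance e x y <= diameter e.
Proof.
apply: leq_trans (leq_bigmax x).
exact: (leq_bigmax (F := fun y => distance e x y)).
Qed.

(** Positivity provides a vertex: over an empty type the maximum is 0 and there is no pair to
    return. *)
Lemma diameter_attained : 0 < diameter e ->
  exists x y, distance e x y = diameter e.
Proof.
have [x0 _|T0] := pickP T; last first.
  by rewrite /diameter big_pred0.
rewrite /diameter; have [|x ->] := @bigop.eq_bigmax T (fun x => \max_y distance e x y).
  by apply/card_gt0P; exists x0.
have [|y ->] := @bigop.eq_bigmax T (fun y => distance e x y).
  by apply/card_gt0P; exists x0.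
by exists x, y.
Qed.

End Distance.

(** * Flows with prescribed divergence and their cost *)

Section Transport.
Local Open Scope ring_scope.
Variables (R : realFieldType) (E I : finType) (M : E -> I -> R) (e : rel I).

(* [M] is an oriented incidence matrix whose rows, up to the zero ones, are
   loops or edges of [e]. *)
Hypothesis row_ends : forall t, (forall i, M t i = 0) \/
  exists a b, (a = b \/ e a b /\ e b a) /\
    forall i, M t i = (i == a)%:R - (i == b)%:R.
Hypothesis edge_row : forall i j, e i j ->
  exists t (s : R), `|s| = 1 /\
    forall k, s * M t k = (k == i)%:R - (k == j)%:R.
Hypothesis e_connected : connected_graph e.

Definition divergence (x : E -> R) i : R := \sum_t x t * M t i.

Lemma sum_indicator_diff (f : I -> R) a b :
  \sum_i f i * ((i == a)%:R - (i == b)%:R) = f a - f b.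
Proof.
under eq_bigr do rewrite mulrBr !mulr_natr !mulrb.
by rewrite sumrB -!big_mkcond !big_pred1_eq.
Qed.

Lemma sum_divergence x : \sum_i divergence x i = 0.
Proof.
rewrite exchange_big big1 // => t _ /=; rewrite -mulr_sumr.
case: (row_ends t) => [M0|[a [b [_ Mab]]]]; first by rewrite big1 ?mulr0.
have -> : \sum_i M t i = \sum_i 1 * ((i == a)%:R - (i == b)%:R).
  by apply: eq_bigr => i _; rewrite Mab mul1r.
by rewrite (sum_indicator_diff (fun=> 1)) subrr mulr0.
Qed.

(* The distance to [v] is a 1-Lipschitz potential on the graph. *)
Lemma flow_norm_ge_distance (x : E -> R) u v :
  (forall i, divergence x i = (i == u)%:R - (i == v)%:R) ->
  (distance e u v)%:R <= \sum_t `|x t|.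
Proof.
move=> dx; pose f i : R := (distance e i v)%:R.
have -> : (distance e u v)%:R = \sum_i f i * divergence x i.
  under eq_bigr do rewrite dx.
  by rewrite sum_indicator_diff /f distance_refl subr0.
under eq_bigr do rewrite mulr_sumr.
rewrite exchange_big; apply: ler_sum => t _ /=.
case: (row_ends t) => [M0|[a [b [ab Mab]]]].
  by rewrite big1 // => i _; rewrite M0 !mulr0.
have -> : \sum_i f i * (x t * M t i) = x t * (f a - f b).
  by rewrite -sum_indicator_diff mulr_sumr; apply: eq_bigr => i _;
     rewrite Mab; ring.
have lip i j : e i j -> f i <= f j + 1.
  by rewrite /f natr1 ler_nat; exact: distance_triangle_edge.
have fab : `|f a - f b| <= 1.
  case: ab => [->|[/lip ? /lip ?]]; first by rewrite subrr normr0.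
  by rewrite ler_norml; lra.
apply: le_trans (ler_norm _) _; rewrite normrM.
by rewrite ler_piMr.
Qed.

(** Rows of simplices outside [K] will be zero, so such flows yield chains of [K]. *)
Definition supported_on_edges (x : E -> R) :=
  forall t, (forall i, M t i = 0) -> x t = 0.

(** One signed unit on the first edge is added to the flow along the rest, and the divergences
    telescope. Repeated edges may cancel, whence only an upper bound on the cost. *)
Lemma path_flow i p : path e i p ->
  exists x, [/\ supported_on_edges x,
    forall k, divergence x k = (k == i)%:R - (k == last i p)%:R
  & \sum_t `|x t| <= (size p)%:R].
Proof.
elim: p i => [|j p IHp] i /=.
  exists (fun=> 0); split=> // [k|]; last by rewrite big1 // => t; rewrite normr0.
  by rewrite subrr /divergence big1 // => t _; rewrite mul0r.
case/andP=> /edge_row[t0 [s [s1 Ms]]] /IHp[x [sx dx nx]].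
(* A zero row forces [i = j]; as it must carry no flow, the flow along the rest is kept
   unchanged. *)
have [Mt0|/existsNP[k0 /eqP Mt0]] := pselect (forall k, M t0 k = 0).
  exists x; split=> // [k|]; last by apply: le_trans nx _; rewrite ler_nat.
  have := Ms k; rewrite Mt0 mulr0 dx => ?; lra.
exists (fun t => (t == t0)%:R * s + x t); split.
- move=> t Mt; rewrite sx // addr0; case: eqP => [tt|_]; last by rewrite mul0r.
  by move: Mt0; rewrite -tt Mt eqxx.
- move=> k; rewrite /divergence.
  under eq_bigr do rewrite mulrDl.
  rewrite big_split /= -/(divergence x k) dx (bigD1 t0) //= big1 => [|t /negPf->].
    by rewrite eqxx mul1r Ms; ring.
  by rewrite !mul0r.
- rewrite -natr1 addrC.
  apply: (@le_trans _ _ (\sum_t ((t == t0)%:R + `|x t|))).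
    apply: ler_sum => t _; apply: le_trans (ler_normD _ _) _.
    by rewrite normrM s1 mulr1 normr_nat.
  rewrite big_split /= (bigD1 t0) //= eqxx big1 => [|t /negPf-> //].
  by rewrite addr0 lerD2l.
Qed.

Lemma geodesic_flow i j : exists x, [/\ supported_on_edges x,
    forall k, divergence x k = (k == i)%:R - (k == j)%:R
  & \sum_t `|x t| <= (distance e i j)%:R].
Proof.
by have [p [ep <- <-]] := distance_path (e_connected i j); exact: path_flow.
Qed.

(* The excess of [d] is shipped from its positive part [P] to its negative part
   [N] along geodesics, [P i * N j / D] units going from [i] to [j]. *)
Lemma transport_flow (d : I -> R) : \sum_i d i = 0 ->
  exists x, [/\ supported_on_edges x, forall k, divergence x k = d k
  & \sum_t `|x t| <= (diameter e)%:R * (\sum_i `|d i|) / 2].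
Proof.
move=> d0; have [g gP] := choice (fun ij => geodesic_flow ij.1 ij.2).
pose P i := (`|d i| + d i) / 2; pose N i := (`|d i| - d i) / 2.
have P0 i : 0 <= P i by have := ler_norm (- d i); rewrite normrN /P; lra.
have N0 i : 0 <= N i by have := ler_norm (d i); rewrite /N; lra.
pose D := (\sum_i `|d i|) / 2.
have PD : \sum_i P i = D by rewrite -mulr_suml big_split /= d0 addr0.
have ND : \sum_i N i = D by rewrite -mulr_suml sumrB d0 subr0.
(* The shipped amounts have denominator [D]; if it vanishes, so does [d], and the zero flow
   serves. *)
have [D0|Dn0] := eqVneq D 0.
  have dz i : d i = 0.
    have /psumr_eq0P /(_ i isT)/normr0P/eqP-> // : \sum_i `|d i| = 0.
    by move: D0; rewrite /D => ?; lra.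
  exists (fun=> 0); split=> // [k|].
    by rewrite dz /divergence big1 // => t _; rewrite mul0r.
  by rewrite -mulrA -/D D0 mulr0 big1 // => t; rewrite normr0.
have Dgt0 : 0 < D by rewrite lt_neqAle eq_sym Dn0 -PD sumr_ge0.
have w_ge0 i j : 0 <= P i * N j / D.
  by apply: divr_ge0 (ltW Dgt0); exact: mulr_ge0.
exists (fun t => \sum_ij P ij.1 * N ij.2 / D * g ij t); split.
- move=> t Mt; apply: big1 => ij _; have [-> //] := gP ij.
  by rewrite mulr0.
- move=> k; rewrite /divergence.
  under eq_bigr do rewrite mulr_suml.
  rewrite exchange_big /=.
  transitivity (\sum_ij P ij.1 * N ij.2 / D * ((k == ij.1)%:R - (k == ij.2)%:R)).
    apply: eq_bigr => ij _; have [_ <- _] := gP ij.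
    by rewrite /divergence mulr_sumr; apply: eq_bigr => t _; rewrite [RHS]mulrA.
  transitivity (\sum_i \sum_j P i * N j / D * ((k == i)%:R - (k == j)%:R)).
    by rewrite pair_bigA.
  have -> : d k = P k - N k by rewrite /P /N; field.
  transitivity (\sum_i (P i * (k == i)%:R - P i * (N k / D))).
    apply: eq_bigr => i _.
    transitivity (\sum_j (P i * (k == i)%:R / D * N j - P i / D * (N j * (k == j)%:R))).
      by apply: eq_bigr => j _; ring.
    rewrite sumrB -!mulr_sumr ND.
    rewrite [\sum_j _](bigD1 k) //= eqxx big1 => [|j]; last first.
      by rewrite eq_sym => /negPf->; rewrite mulr0.
    by rewrite mulr1n; field.
  rewrite sumrB -mulr_suml PD.
  rewrite (bigD1 k) //= eqxx big1 => [|j]; last first.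
    by rewrite eq_sym => /negPf->; rewrite mulr0.
  by rewrite mulr1n; field.
- apply: (@le_trans _ _ (\sum_t \sum_ij P ij.1 * N ij.2 / D * `|g ij t|)).
    apply: ler_sum => t _; apply: le_trans (ler_norm_sum _ _ _) _.
    apply: ler_sum => ij _; by rewrite normrM ger0_norm ?w_ge0.
  rewrite exchange_big /=.
  apply: (@le_trans _ _ (\sum_ij P ij.1 * N ij.2 / D * (diameter e)%:R)).
    apply: ler_sum => ij _; rewrite -mulr_sumr ler_wpM2l ?w_ge0 //.
    have [_ _ /le_trans->//] := gP ij.
    by rewrite ler_nat distance_le_diameter.
  rewrite -!mulr_suml.
  (* The total amount shipped is thus [D * D / D = D], half the 1-norm of [d]. *)
  have -> : \sum_ij P ij.1 * N ij.2 = D * D.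
    rewrite -{1}PD mulr_suml -(pair_bigA _ (fun i j => P i * N j)) /=.
    by apply: eq_bigr => i _; rewrite -mulr_sumr ND.
  by rewrite mulfK // mulrC -mulrA.
Qed.

End Transport.

(** * Boundary, coboundary and orthogonal projection of chains *)

Section Chains.
Local Open Scope ring_scope.
Variables (R : realType) (V : finType).
Implicit Types (K L : {set {set V}}) (q : nat) (s t : {set V}) (o : {set V} -> bool).
Implicit Types x y : chain R V.

Lemma chainsP L q x :
  x \in chains R L q <-> (forall s, s \notin simplices L q -> x s = 0).
Proof.
split=> [|x0].
  rewrite /chains => /(coord_span (X := in_tuple _)) -> s sL.
  rewrite sum_ffunE big1 // => i _; rewrite ffunE.
  have /mapP[t tL ->] : (in_tuple [seq simplex_chain R s | s <- enum (simplices L q)])`_i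
      \in [seq simplex_chain R s | s <- enum (simplices L q)].
    by rewrite mem_nth.
  rewrite mem_enum in tL; rewrite ffunE; case: eqP => [st|_]; last by rewrite scaler0.
  by rewrite st tL in sL.
have -> : x = \sum_(s in simplices L q) (x s : R) *: simplex_chain R s.
  apply/ffunP => t; rewrite sum_ffunE.
  under eq_bigr do rewrite !ffunE.
  have [tL|tL] := boolP (t \in simplices L q).
    rewrite (bigD1 t) //= eqxx big1 => [|s /andP[_]]; last first.
      by rewrite eq_sym => /negPf->; rewrite scaler0.
    by rewrite addr0 [RHS]mulr1.
  rewrite x0 // big1 // => s sL; case: eqP => [ts|_]; last by rewrite scaler0.
  by rewrite ts sL in tL.
by apply: memv_suml => s sL; apply/memvZ/memv_span/map_f; rewrite mem_enum.
Qed.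

Lemma incidence_eq0 o t s : ~~ (t \subset s) -> incidence R o t s = 0.
Proof.
move=> ts; rewrite /incidence big1 ?mulr0 // => v /andP[_ /eqP tE].
by case/negP: ts; rewrite -tE subD1set.
Qed.

(** A facet omits exactly one vertex, so the defining sum reduces to a single sign. *)
Lemma incidence_facet o t s : t \subset s -> #|s| = #|t|.+1 ->
  incidence R o t s = 1 \/ incidence R o t s = -1.
Proof.
move=> ts cs; have /cards1P[v stv] : #|s :\: t| == 1%N.
  by rewrite cardsD (finset.setIidPr ts) cs subSnn.
have /finset.setDP[vs vt] : v \in s :\: t by rewrite stv finset.set11.
have tE : s :\ v = t by rewrite -stv finset.setDDr finset.setDv finset.set0U (finset.setIidPr ts).
rewrite /incidence (big_pred1 v) => [|w]; last first.
  apply/andP/eqP => [[ws /eqP sw]|->]; last by rewrite vs tE.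
  have : w \in s :\: t by rewrite -sw !inE eqxx ws.
  by rewrite stv => /set1P.
rewrite -!exprD -signr_odd.
by case: (odd _); [right|left]; rewrite ?expr1 ?expr0.
Qed.

(** Without boundary, [t] has no coface or two, and the orientations give those two opposite signs;
    the positive one is listed first. *)
Lemma boundary_row L q o t :
  oriented_pseudomanifold R L q o -> without_boundary L q -> t \in simplices L q ->
  (forall x, boundary L q o x t = 0) \/
  exists s s', [/\ s \in simplices L q.+1, s' \in simplices L q.+1
    & forall x, boundary L q o x t = x s - x s'].
Proof.
move=> [_ _ _ opp] wb tL.
have bE x : boundary L q o x t = \sum_(s in cofaces L q t) incidence R o t s * x s.
  rewrite ffunE tL (bigID (fun s => t \subset s)) /= [X in _ + X]big1 ?addr0.
    by apply: eq_bigl => s; rewrite [in RHS]inE.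
  by move=> s /andP[_ /incidence_eq0->]; rewrite mul0r.
case: (wb t tL) => [/eqP|/eqP/cards2P[s [s' [ss' cE]]]].
  rewrite cards_eq0 => /eqP c0; left=> x.
  by rewrite bE c0 big_set0.
have cof u : u \in cofaces L q t ->
    u \in simplices L q.+1 /\ (incidence R o t u = 1 \/ incidence R o t u = -1).
  move=> ucof; move: (ucof); rewrite inE => /andP[uL tu]; split=> //.
  apply: incidence_facet => //; move: uL tL; rewrite !inE.
  by move=> /andP[_ /eqP->] /andP[_ /eqP->].
have sc : s \in cofaces L q t by rewrite cE set21.
have sc' : s' \in cofaces L q t by rewrite cE set22.
have bss x : boundary L q o x t = incidence R o t s * (x s - x s').
  rewrite bE cE big_setU1 ?inE //= big_set1 (opp t s' s) // 1?eq_sym //.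
  by rewrite mulrBr (opp t s s') // mulNr opprK addrC; ring.
have [sL [i1|i1]] := cof s sc; have [sL' _] := cof s' sc'; right.
  by exists s, s'; split=> // x; rewrite bss i1 mul1r.
by exists s', s; split=> // x; rewrite bss i1 mulN1r opprB.
Qed.

(** Adjointness of [coboundary] and [boundary]; [K \subset L] keeps [boundary] from taking its
    default value 0 on [simplices K q]. *)
Lemma inner_coboundary K L q o x y : K \subset L ->
  inner (coboundary K L q o x) y =
  \sum_(t in simplices K q) x t * boundary L q o y t.
Proof.
move=> KL; rewrite /inner.
transitivity (\sum_(s in simplices L q.+1) \sum_(t in simplices K q)
    x t * (incidence R o t s * y s)).
  rewrite [RHS]big_mkcond; apply: eq_bigr => s _; rewrite ffunE.
  case: ifP => _; last by rewrite mul0r.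
  by rewrite mulr_suml; apply: eq_bigr => t _; rewrite mulrAC mulrC mulrA.
rewrite exchange_big; apply: eq_bigr => t tK /=.
rewrite ffunE; case: ifPn => [_|]; first by rewrite mulr_sumr.
by move: tK; rewrite !inE => /andP[/(fintype.subsetP KL)-> ->].
Qed.

Lemma inner_eq0 x : inner x x = 0 -> x = 0.
Proof.
move=> xx; apply/ffunP => s; rewrite ffunE; apply/eqP; rewrite -sqrf_eq0 expr2.
by move/psumr_eq0P: xx => -> // u _; rewrite -expr2 sqr_ge0.
Qed.

(** Two candidates differ by an element of [W] orthogonal to itself, so [xget] can only return
    [y]. *)
Lemma projection_eq (W : {vspace chain R V}) x y :
  is_orthogonal_projection W x y -> projection W x = y.
Proof.
move=> [yW xy]; apply: xget_unique => // z [zW xz].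
apply/eqP; rewrite -subr_eq0; apply/eqP/inner_eq0.
have zyW : z - y \in W by rewrite memvB.
transitivity (inner (x - y) (z - y) - inner (x - z) (z - y)).
  by rewrite /inner -sumrB; apply: eq_bigr => s _; rewrite !ffunE; ring.
by rewrite xy // xz // subr0.
Qed.

End Chains.

(** * The indicator basis and the projected coboundary as a divergence *)

Section IndicatorBasis.
Local Open Scope ring_scope.
Variables (R : realType) (V : finType) (q : nat) (K L : {set {set V}}).
Variables (o : {set V} -> bool) (m : nat) (c : m.-tuple (chain R V)).
Hypothesis KL : K \subset L.
Hypothesis L_oriented : oriented_pseudomanifold R L q o.
Hypothesis L_closed : without_boundary L q.
Hypothesis c_basis : disjoint_indicator_basis K L q o c.

Notation W := (relative_chains R K L q o).
Notation e := (dual_graph K L q o c).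

Lemma indicator_mem i : tnth c i \in W.
Proof. by have [/basis_mem-> //] := c_basis; exact: mem_tnth. Qed.

Lemma relative_chainsP (x : chain R V) : x \in W <->
  (forall s, s \notin simplices L q.+1 -> x s = 0) /\
  (forall t, t \notin simplices K q -> boundary L q o x t = 0).
Proof.
rewrite memv_cap -memv_preim lfunE /=; split=> [/andP[/chainsP xL /chainsP dK]//|].
by move=> [/chainsP-> /chainsP->].
Qed.

(* The all-ones chain is a cycle by orientability, so the supports of the basis
   chains cover all top simplices. *)
Lemma basis_cover s : s \in simplices L q.+1 ->
  exists a, forall i, tnth c i s = (i == a)%:R.
Proof.
move=> sL; pose u : chain R V := [ffun s => (s \in simplices L q.+1)%:R].
have uW : u \in W.
  apply/relative_chainsP; split=> [t /negPf tL|t _]; first by rewrite ffunE tL.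
  have [tL|tL] := boolP (t \in simplices L q); last by rewrite ffunE (negPf tL).
  have [->//|[s1 [s2 [s1L s2L ->]]]] := boundary_row L_oriented L_closed tL.
  by rewrite !ffunE s1L s2L subrr.
have [bc c01 cdisj] := c_basis.
have [a ca|c0] := pickP (fun a => tnth c a s != 0); last first.
  have /ffunP/(_ s) := coord_basis bc uW.
  rewrite ffunE sL sum_ffunE big1 => [/eqP|i _]; first by rewrite oner_eq0.
  by rewrite ffunE -tnth_nth (eqP (negbFE (c0 i))) scaler0.
exists a => i; have [->|ia] := eqVneq i a.
  by case: (c01 a s) => // /eqP; rewrite (negPf ca).
by case: (cdisj i a s ia) => // /eqP; rewrite (negPf ca).
Qed.

Lemma basis_off i s : s \notin simplices L q.+1 -> tnth c i s = 0.
Proof. by have /relative_chainsP[+ _] := indicator_mem i; apply. Qed.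

(** Since the values are 0 and 1, this is also the squared norm of the basis chain. *)
Let volume i := \sum_s (tnth c i s : R).

Lemma volume_gt0 i : 0 < volume i.
Proof.
have [bc c01 _] := c_basis.
have c0 s : 0 <= (tnth c i s : R) by case: (c01 i s) => ->.
rewrite lt_neqAle eq_sym sumr_ge0 // andbT; apply/eqP => /psumr_eq0P z.
have := free_not0 (basis_free bc) (mem_tnth i c).
case/eqP; apply/ffunP => s; rewrite ffunE; exact: z.
Qed.

Lemma inner_basis i j : inner (tnth c i) (tnth c j) = (i == j)%:R * volume i.
Proof.
rewrite mulr_sumr; apply: eq_bigr => s _.
have [sL|sL] := boolP (s \in simplices L q.+1); last by rewrite basis_off // mul0r mulr0.
have [a ca] := basis_cover sL; rewrite !ca -!natrM.
have [->|ij] := eqVneq i j; first by case: (j == a).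
have [ia|//] := eqVneq i a; have [ja|//] := eqVneq j a.
by rewrite ia ja eqxx in ij.
Qed.

(** Extended by 0 to all vertex sets, so that a chain is directly a flow with edges indexed by
    [{set V}]. *)
Definition relative_row t i : R :=
  if t \in simplices K q then relative_boundary L q o c t i else 0.

(* Up to the weights [volume i], P B^T x is the divergence of [x] seen as a flow on
   the dual graph; the weights cancel in the 1-norm. *)
Lemma projected_coboundaryE (x : chain R V) :
  projected_coboundary K L q o x =
  \sum_i (divergence relative_row x i / volume i) *: tnth c i.
Proof.
have [bc _ _] := c_basis.
apply: projection_eq; split.
  by apply: memv_suml => i _; apply: memvZ; exact: indicator_mem.
set y := \sum_i _ *: _.
(* Against [tnth c j] both terms give the divergence at [j]: the first by adjointness, the second
   because the weight cancels the squared norm. *)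
have yc j : inner (coboundary K L q o x - y) (tnth c j) = 0.
  transitivity (inner (coboundary K L q o x) (tnth c j) - inner y (tnth c j)).
    by rewrite /inner -sumrB; apply: eq_bigr => s _; rewrite !ffunE; ring.
  rewrite inner_coboundary //.
  have -> : inner y (tnth c j) =
      \sum_i divergence relative_row x i / volume i * inner (tnth c i) (tnth c j).
    rewrite /inner; under [RHS]eq_bigr do rewrite mulr_sumr.
    rewrite exchange_big; apply: eq_bigr => s _ /=.
    rewrite sum_ffunE mulr_suml; apply: eq_bigr => i _.
    by rewrite ffunE mulrA.
  rewrite (bigD1 j) //= [\sum_(i | i != j) _]big1 => [|i ij]; last first.
    by rewrite inner_basis (negPf ij) mul0r mulr0.
  rewrite inner_basis eqxx mul1r divfK ?gt_eqF ?volume_gt0 // addr0.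
  apply/eqP; rewrite subr_eq0; apply/eqP.
  rewrite /divergence big_mkcond; apply: eq_bigr => t _.
  by rewrite /relative_row; case: ifP => //; rewrite mulr0.
move=> w /(coord_basis bc) ->.
transitivity (\sum_j coord c j w * inner (coboundary K L q o x - y) (tnth c j)).
  rewrite /inner; under [RHS]eq_bigr do rewrite mulr_sumr.
  rewrite [RHS]exchange_big; apply: eq_bigr => s _ /=.
  rewrite sum_ffunE mulr_sumr; apply: eq_bigr => i _.
  by rewrite -tnth_nth [X in _ * X]ffunE; exact: mulrCA.
by rewrite big1 // => j _; rewrite yc mulr0.
Qed.

Lemma norm1_projected_coboundary (x : chain R V) :
  norm1 (projected_coboundary K L q o x) =
  \sum_i `|divergence relative_row x i|.
Proof.
rewrite projected_coboundaryE /norm1.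
set d := divergence _ _.
(* Supports are disjoint, so at most one summand is nonzero at each [s] and the absolute value
   passes inside the sum. *)
transitivity (\sum_s \sum_i `|d i| / volume i * tnth c i s).
  apply: eq_bigr => s _; rewrite sum_ffunE.
  have [sL|sL] := boolP (s \in simplices L q.+1); last first.
    by rewrite !big1 ?normr0 // => i _; rewrite ?ffunE basis_off // ?scaler0 ?mulr0.
  have [a ca] := basis_cover sL.
  rewrite (bigD1 a) //= [in RHS](bigD1 a) //= !big1 => [|i ia|i ia].
  - by rewrite ffunE ca eqxx !addr0 mulr1 [_ *: _]mulr1 normrM normfV
      (gtr0_norm (volume_gt0 a)).
  - by rewrite ca (negPf ia) mulr0.
  - by rewrite ffunE ca (negPf ia) scaler0.
rewrite exchange_big; apply: eq_bigr => i _ /=.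
by rewrite -mulr_sumr divfK // gt_eqF ?volume_gt0.
Qed.

Lemma projected_coboundary_eq0 (x : chain R V) :
  (forall i, divergence relative_row x i = 0) -> projected_coboundary K L q o x = 0.
Proof.
move=> d0; rewrite projected_coboundaryE big1 // => i _.
by rewrite d0 mul0r scale0r.
Qed.

(** * From matrix rows to edges of the dual graph *)

(** Each of the two cofaces lies in the support of exactly one basis chain; [a = b] when both lie in
    the same one, and the row is then zero. *)
Lemma relative_boundary_row t : t \in simplices K q ->
  (forall i, relative_boundary L q o c t i = 0) \/
  exists a b, forall i, relative_boundary L q o c t i = (i == a)%:R - (i == b)%:R.
Proof.
move=> tK; have tL : t \in simplices L q.
  by move: tK; rewrite !inE => /andP[/(fintype.subsetP KL)-> ->].
have [b0|[s [s' [sL sL' bE]]]] := boundary_row L_oriented L_closed tL.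
  by left=> i; exact: b0.
right; have [a ca] := basis_cover sL; have [b cb] := basis_cover sL'.
by exists a, b => i; rewrite /relative_boundary bE ca cb.
Qed.

Lemma dual_ends_pair t a b : a != b ->
  (forall i, relative_boundary L q o c t i = (i == a)%:R - (i == b)%:R) ->
  dual_ends L q o c t = [set a; b].
Proof.
move=> ab bE; apply/finset.setP => i; rewrite !inE bE.
have [->|ia] := eqVneq i a; first by rewrite (negPf ab) subr0 oner_eq0.
by case: (i == b); rewrite mulr0n sub0r oppr_eq0 ?oner_eq0 ?eqxx.
Qed.

Lemma relative_row_ends t : (forall i, relative_row t i = 0) \/
  exists a b, (a = b \/ e a b /\ e b a) /\
    forall i, relative_row t i = (i == a)%:R - (i == b)%:R.
Proof.
rewrite /relative_row; have [tK|_] := boolP (t \in _); last by left.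
have [b0|[a [b abE]]] := relative_boundary_row tK; [by left | right].
exists a, b; split=> //; have [ab|ab] := eqVneq a b; [by left | right].
have tE := dual_ends_pair ab abE.
have tD : t \in dual_edges K L q o c.
  by rewrite inE tK tE; apply/set0Pn; exists a; rewrite set21.
by split; apply/fintype.existsP; exists t; rewrite tD tE //= finset.setUC.
Qed.

(** The ends of an edge form an unordered pair, so a sign [s] is needed to direct its row from [i]
    to [j]. *)
Lemma dual_graph_row i j : e i j -> exists t (s : R), `|s| = 1 /\
  forall k, s * relative_row t k = (k == i)%:R - (k == j)%:R.
Proof.
move=> /fintype.existsP[t /andP[]]; rewrite inE => /andP[tK t0] /eqP tE.
exists t; rewrite /relative_row tK.
have [b0|[a [b abE]]] := relative_boundary_row tK.
  by move: t0 => /set0Pn[k]; rewrite inE b0 eqxx.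
have ab : a != b.
  apply: contra t0 => /eqP ab; apply/eqP/finset.setP => k.
  by rewrite !inE abE ab subrr eqxx.
have abij : [set a; b] = [set i; j] by rewrite -tE (dual_ends_pair ab abE).
have : a \in [set i; j] by rewrite -abij set21.
have : b \in [set i; j] by rewrite -abij set22.
have : i \in [set a; b] by rewrite abij set21.
have : j \in [set a; b] by rewrite abij set22.
have key : (a = i /\ b = j) \/ (a = j /\ b = i) -> exists s : R, `|s| = 1 /\
    forall k, s * relative_boundary L q o c t k = (k == i)%:R - (k == j)%:R.
  case=> [[<- <-]|[<- <-]].
    by exists 1; rewrite normr1; split=> // k; rewrite mul1r abE.
  by exists (-1); rewrite normrN normr1; split=> // k; rewrite mulN1r abE opprB.
(* Apart from the two matchings of [a, b] with [i, j], every pattern would identify [a] with [b]. *)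
move=> /set2P[] ja /set2P[] ib /set2P[] bi /set2P[] aj; apply: key; move: ab;
  rewrite ?ja ?ib ?bi ?aj ?eqxx //; subst; rewrite ?eqxx //; by [left|right].
Qed.

(** * Chains of minimal 1-norm on a connected dual graph *)

Hypothesis e_connected : connected_graph e.

Lemma divergenceB (x y : chain R V) i :
  divergence relative_row (x - y) i =
  divergence relative_row x i - divergence relative_row y i.
Proof.
by rewrite /divergence -sumrB; apply: eq_bigr => t _; rewrite !ffunE mulrBl.
Qed.

Lemma supported_chain (x : {set V} -> R) :
  supported_on_edges relative_row x -> ([ffun t => x t] : chain R V) \in chains R K q.
Proof.
move=> sx; apply/chainsP => t /negPf tK; rewrite ffunE sx // => i.
by rewrite /relative_row tK.
Qed.

Lemma divergence_chain (x : {set V} -> R) i :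
  divergence relative_row ([ffun t => x t] : chain R V) i = divergence relative_row x i.
Proof. by apply: eq_bigr => t _; rewrite ffunE. Qed.

Lemma norm1_chain (x : {set V} -> R) :
  norm1 ([ffun t => x t] : chain R V) = \sum_t `|x t|.
Proof. by apply: eq_bigr => t _; rewrite ffunE. Qed.

Lemma norm1_le_diameter (x : chain R V) : x \in chains R K q ->
  orthogonal1 x (projected_coboundary_ker K L q o) ->
  norm1 x <= (diameter e)%:R * norm1 (projected_coboundary K L q o x) / 2.
Proof.
move=> xK xmin; rewrite norm1_projected_coboundary.
have [y [sy dy ny]] := transport_flow dual_graph_row e_connected
  (sum_divergence relative_row_ends x).
apply: le_trans ny; rewrite -norm1_chain.
set z : chain R V := [ffun t => y t].
(* [z] has the divergence of [x], so [z - x] is a kernel element against which 1-orthogonality can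
   be tested. *)
have <- : x + (z - x) = z by rewrite addrC subrK.
apply: xmin; split; first by rewrite memvB // supported_chain.
apply: projected_coboundary_eq0 => i.
by rewrite divergenceB divergence_chain dy subrr.
Qed.

Lemma diametral_chain : (0 < diameter e)%N -> exists x : chain R V,
  [/\ x \in chains R K q, orthogonal1 x (projected_coboundary_ker K L q o),
      norm1 x = (diameter e)%:R & norm1 (projected_coboundary K L q o x) = 2].
Proof.
move=> D0; have [u [v uv]] := diameter_attained D0.
have [x [sx dx nx]] := geodesic_flow dual_graph_row e_connected u v.
pose X : chain R V := [ffun t => x t].
have dX i : divergence relative_row X i = (i == u)%:R - (i == v)%:R.
  by rewrite divergence_chain.
have nX : norm1 X = (diameter e)%:R.
  apply/eqP; rewrite eq_le -{1}uv {1}norm1_chain nx -uv /=.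
  by rewrite /norm1 (flow_norm_ge_distance relative_row_ends e_connected dX).
exists X; split=> //; first exact: supported_chain.
(* Adding a kernel element keeps the divergence, so the potential bound applies to [X + y] as
   well. *)
- move=> y [yK Py]; rewrite nX -uv /norm1.
  apply: (flow_norm_ge_distance relative_row_ends e_connected) => i.
  rewrite -[y in X + y]opprK divergenceB dX.
  have y0 : divergence relative_row y i = 0.
    have : \sum_i `|divergence relative_row y i| = 0.
      rewrite -norm1_projected_coboundary Py /norm1 big1 // => s _.
      by rewrite ffunE normr0.
    by move/psumr_eq0P => /(_ (fun i _ => normr_ge0 _) i isT)/normr0P/eqP.
  have -> : divergence relative_row (- y) i = 0.
    by rewrite -[- y]sub0r divergenceB y0 subr0 /divergence big1 // => t _;
       rewrite ffunE mul0r.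
  by rewrite subr0.
- rewrite norm1_projected_coboundary.
  (* Positive diameter separates [u] from [v], so their unit contributions add up to 2 instead of
     cancelling. *)
  have uv' : u != v.
    by apply: contraTneq D0 => E; rewrite -uv E distance_refl.
  rewrite (bigD1 u) //= (bigD1 v) /=; last by rewrite eq_sym.
  rewrite big1 => [|i /andP[iu iv]]; last first.
    by rewrite dX (negPf iu) (negPf iv) subrr normr0.
  rewrite !dX !eqxx (negPf uv') eq_sym (negPf uv') subr0 sub0r normrN normr1 addr0.
  by [].
Qed.

End IndicatorBasis.

Theorem proposition6p3 (R : realType) (V : finType) (q : nat)
    (K L : {set {set V}}) (o : {set V} -> bool)
    (m : nat) (c : m.-tuple (chain R V))
    (hK : simplicial_complex K) (hKL : K \subset L)
    (hL : oriented_pseudomanifold R L q o) (hL0 : without_boundary L q)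
    (hc : disjoint_indicator_basis K L q o c)
    (hG : connected_graph (dual_graph K L q o c)) :
  cheeger R K L q o = (2%:E / (diameter (dual_graph K L q o c))%:R%:E)%E /\
  (cheeger_ratios R K L q o !=set0 ->
     cheeger_ratios R K L q o (cheeger R K L q o))%classic.
Proof.
set D := diameter _.
have norm_le x := norm1_le_diameter hKL hL hL0 hc hG (x := x).
have norm_gt0 (x : chain R V) : x != 0%R -> (0 < norm1 x)%R.
  move=> xn0; rewrite lt_neqAle eq_sym sumr_ge0 // andbT.
  apply: contra xn0 => /eqP/psumr_eq0P x0; apply/eqP/ffunP => s.
  by rewrite ffunE; have /normr0P/eqP := x0 (fun s _ => normr_ge0 _) s isT.
(* With diameter 0 no chain is admissible: the infimum of the empty set is [+oo], which agrees with
   [2 / 0] in [\bar R]. *)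
have [D0|Dgt0] := posnP D.
  have no_ratio : cheeger_ratios R K L q o = set0.
    apply/seteqP; split=> // r [x [xK /norm_gt0 + xmin _]].
    by rewrite ltNge (le_trans (norm_le x xK xmin)) // -/D D0 !mul0r.
  split; last by rewrite no_ratio => -[].
  by rewrite /cheeger no_ratio ereal_inf0 D0 inve0 gt0_muley // lte_fin.
have [x [xK xmin nx nPx]] := diametral_chain hKL hL hL0 hc hG Dgt0.
have D0 : (0 < D%:R :> R)%R by rewrite ltr0n.
have x0 : x != 0%R.
  apply: contraTneq D0 => xz; rewrite /D -nx xz /norm1 big1 ?ltxx // => s _.
  by rewrite ffunE normr0.
have DE : (2%:E / D%:R%:E)%E = (2 / D%:R : R)%R%:E by rewrite inver gt_eqF // -EFinM.
(* Membership gives both the upper bound on the infimum and its attainment. *)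
have in_ratios : cheeger_ratios R K L q o (2%:E / D%:R%:E)%E.
  by exists x; split=> //; rewrite nx nPx DE.
have cE : cheeger R K L q o = (2%:E / D%:R%:E)%E.
  apply/eqP; rewrite eq_le; apply/andP; split; first exact: ereal_inf_lbound.
  apply: le_ereal_inf_tmp => r [y [yK y0 ymin ->]].
  rewrite DE lee_fin ler_pdivlMr ?norm_gt0 // -mulrAC ler_pdivrMr //.
  have := norm_le y yK ymin; rewrite -/D; lra.
by split=> // _; rewrite cE.
Qed.
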